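(* There is a one-to-one correspondence between projective equivalence classes of simple valuated matroids (on finite sets) and isomorphism classes of finitely generated geometric $\mathbb{R}_{\max}$-modules, given by sending the projective equivalence class of a simple valuated matroid $M$ to the isomorphism class of the $\mathbb{R}_{\max}$-module $Q_M$.
   Context: $\mathbb{R}_{\max}=\mathbb{R}\cup\{-\infty\}$ with addition $\max$ and multiplication the usual addition of reals, written multiplicatively; zero $0:=-\infty$, unit $1$ (the real number $0$), $\mathbb{R}_{\max}^\times=\mathbb{R}$. Modules are commutative monoids with an action satisfying the usual module axioms; a module over $\mathbb{R}_{\max}$ is ordered by $x\le y\iff x+y=y$. Valuated matroid on a finite set $E$ (circuit description): a collection $\mathcal{C}\subseteq \mathbb{R}_{\max}^E$ of functions, called circuits, such that, writing $\underline{X}=\{e\in E\mid X(e)\ne-\infty\}$: the constant function $-\infty$ is not in $\mathcal{C}$; if $X,Y\in\mathcal{C}$ and $\underline X\neq\underline Y$ then $\underline X\not\subseteq\underline Y$; if $X\in\mathcal{C}$ and $a\in\mathbb{R}_{\max}^\times$ then $aX\in\mathcal{C}$; and for $X,Y\in\mathcal{C}$ and $u,v\in E$ with $X(u)=Y(u)\neq-\infty$ and $X(v)>Y(v)$ there is $Z\in\mathcal{C}$ with $Z(u)=-\infty$, $Z(v)=X(v)$ and $Z\le\max(X,Y)$ pointwise. It is simple if every circuit has support of size at least $3$ (the underlying matroid is simple). $Q_M$ is the quotient of the free $\mathbb{R}_{\max}$-module on $E$ by the congruence generated by $\sum_{y\in E}c(y)y=\sum_{y\in E\setminus\{x\}}c(y)y$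 for every circuit $c$ and every $x\in E$. Projective equivalence from $M$ (on $E$) to $M'$ (on $E'$): a pair $(\phi,s)$ with $\phi:E\to E'$ a bijection and $s:E\to\mathbb{R}_{\max}^\times$ such that $\eta:E\to\mathbb{R}_{\max}$ is a circuit of $M$ iff $y\mapsto s(\phi^{-1}(y))\eta(\phi^{-1}(y))$ is a circuit of $M'$. $M,M'$ are projectively equivalent if such a pair exists. Let $N$ be an $\mathbb{R}_{\max}$-module, $\mathcal{O}=\{a\in\mathbb{R}_{\max}\mid a\le1\}$. For $x\le y$ in $N$, $[x,y]=\{z\mid x\le z\le y\}$. $y$ weakly covers $x$ ($x\preceq y$) if $x\le y$ and every element of $[x,y]$ has the form $x+ay$ with $a\in\mathcal{O}$. $y$ covers $x$ if $x\le y$ and $\mathcal{O}\to[x,y]$, $a\mapsto x+ay$, is a bijection. $x$ is an atom if it covers $0$. $N$ is atomic if every element is a (finite, possibly empty) sum of atoms. $N$ is semimodular if $x\preceq y$ implies $x+z\preceq y+z$ for all $x,y,z\in N$. $N$ is strongly torsion-free if (i) $ax\ne0$ whenever $x\in N\setminus\{0\}$ and $a\in\mathbb{R}_{\max}\setminus\{0\}$, and (ii) whenever $x\le y$ in $N$, $a,b\in\mathcal{O}$ and $x+ay=x+by$, then $a=b$ or $x=x+ay=x+by$. $N$ is geometric if it is atomic, semimodular and strongly torsion-free. *)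

(* Defs.v *)
From HB Require Import structures.
From mathcomp Require Import all_boot all_order all_algebra.
From mathcomp Require Import boolp classical_sets functions reals.

Set Implicit Arguments.
Unset Strict Implicit.
Unset Printing Implicit Defensive.

Import Order.TTheory GRing.Theory Num.Theory.
Local Open Scope ring_scope.
Local Open Scope quotient_scope.

(* [None] is -oo and [Some r] is the real number [r]. In [ring_scope],
   [x + y] is the maximum, [x * y] is the usual sum of reals, [0] is -oo and
   [1] is the real number 0; [<=] and [<] are the usual order of the reals
   extended by -oo (see [Rmax_leE]). The set of nonzero elements is the group of
   invertible elements. *)
Definition Rmax (R : realType) : Type := option R.

HB.instance Definition _ (R : realType) := Choice.on (Rmax R).

Section RmaxStructure.
Variable R : realType.
Implicit Types x y z : Rmax R.

Definition Rmax_le x y : bool :=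
  match x, y with
  | None, _ => true
  | Some _, None => false
  | Some a, Some b => a <= b
  end.

Definition Rmax_max x y : Rmax R :=
  match x, y with
  | None, _ => y
  | _, None => x
  | Some a, Some b => Some (Num.max a b)
  end.

Definition Rmax_min x y : Rmax R :=
  match x, y with
  | Some a, Some b => Some (Num.min a b)
  | _, _ => None
  end.

Definition Rmax_plus x y : Rmax R :=
  match x, y with
  | Some a, Some b => Some (a + b)
  | _, _ => None
  end.

Definition Rmax_lt x y : bool := (y != x) && Rmax_le x y.

Fact Rmax_lt_def x y : Rmax_lt x y = (y != x) && Rmax_le x y.
Proof. by []. Qed.

Fact Rmax_lt_fin (a b : R) :
  Rmax_lt (Some a : Rmax R) (Some b : Rmax R) = (a < b).
Proof. by rewrite /Rmax_lt /= lt_neqAle eq_sym. Qed.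

Fact Rmax_min_def x y : Rmax_min x y = if Rmax_lt x y then x else y.
Proof.
case: x y => [a|] [b|] //.
by rewrite Rmax_lt_fin /= minEgt; case: ltgtP => // ->.
Qed.

Fact Rmax_max_def x y : Rmax_max x y = if Rmax_lt x y then y else x.
Proof.
case: x y => [a|] [b|] //.
by rewrite Rmax_lt_fin /= maxEgt; case: ltgtP => // ->.
Qed.

Fact Rmax_le_anti : antisymmetric Rmax_le.
Proof. by move=> [a|] [b|] //= /le_anti ->. Qed.

Fact Rmax_le_trans : transitive Rmax_le.
Proof. by move=> [a|] [b|] [c|] //=; apply: le_trans. Qed.

Fact Rmax_le_total : total Rmax_le.
Proof. by move=> [a|] [b|] //=; apply: le_total. Qed.

HB.instance Definition _ := Order.isOrder.Build ring_display (Rmax R)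
  Rmax_lt_def Rmax_min_def Rmax_max_def Rmax_le_anti Rmax_le_trans
  Rmax_le_total.

Fact Rmax_maxA : associative Rmax_max.
Proof. by move=> [a|] [b|] [c|] //=; rewrite maxA. Qed.

Fact Rmax_maxC : commutative Rmax_max.
Proof. by move=> [a|] [b|] //=; rewrite maxC. Qed.

Fact Rmax_max0 : left_id None Rmax_max.
Proof. by case. Qed.

HB.instance Definition _ :=
  GRing.isNmodule.Build (Rmax R) Rmax_maxA Rmax_maxC Rmax_max0.

Fact Rmax_plusA : associative Rmax_plus.
Proof. by move=> [a|] [b|] [c|] //=; rewrite addrA. Qed.

Fact Rmax_plusC : commutative Rmax_plus.
Proof. by move=> [a|] [b|] //=; rewrite addrC. Qed.

Fact Rmax_plus1 : left_id (Some 0) Rmax_plus.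
Proof. by case=> [a|] //=; rewrite add0r. Qed.

Fact Rmax_plusDl : left_distributive Rmax_plus (@GRing.add (Rmax R)).
Proof.
move=> x y z; rewrite -[x + y]/(Rmax_max x y) -[RHS]/(Rmax_max _ _).
by case: x y z => [a|] [b|] [c|] //=; rewrite addr_maxl.
Qed.

Fact Rmax_plus0 : left_zero (0 : Rmax R) Rmax_plus.
Proof. by []. Qed.

Fact Rmax_1_neq0 : (Some 0 : Rmax R) != 0.
Proof. by []. Qed.

HB.instance Definition _ := GRing.Nmodule_isComNzSemiRing.Build (Rmax R)
  Rmax_plusA Rmax_plusC Rmax_plus1 Rmax_plusDl Rmax_plus0 Rmax_1_neq0.

(* [Rmax R] as a module over itself, so that [{ffun E -> Rmax R}] is the free
   module on [E]. *)
Fact Rmax_scalerDr : right_distributive (@GRing.mul (Rmax R)) +%R.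
Proof. exact: mulrDr. Qed.

Fact Rmax_scalerDl (v : Rmax R) :
  {morph (@GRing.mul (Rmax R))^~ v : a b / a + b}.
Proof. by move=> a b; rewrite mulrDl. Qed.

HB.instance Definition _ :=
  GRing.Nmodule_isLSemiModule.Build (Rmax R) (Rmax R)
    (@mulrA (Rmax R)) (@mul0r (Rmax R)) (@mul1r (Rmax R))
    Rmax_scalerDr Rmax_scalerDl.

Lemma Rmax_leE x y : (x <= y) = (x + y == y).
Proof.
rewrite -[x <= y]/(Rmax_le x y) -[x + y]/(Rmax_max x y).
case: x y => [a|] [b|] //=; last by rewrite eqxx.
apply/idP/eqP => [ab|[]]; first by rewrite max_r.
by move=> /max_idPr.
Qed.

End RmaxStructure.

Section QuotientModule.
Variables (K : pzSemiRingType) (V : lSemiModType K).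

Record congruence (r : V -> V -> Prop) : Prop := Congruence {
  cong_refl : forall u, r u u;
  cong_sym : forall u v, r u v -> r v u;
  cong_trans : forall u v w, r u v -> r v w -> r u w;
  cong_add : forall u u' v v', r u u' -> r v v' -> r (u + v) (u' + v');
  cong_scale : forall (a : K) u v, r u v -> r (a *: u) (a *: v)
}.

Definition gen_cong (S : V -> V -> Prop) (u v : V) : Prop :=
  forall r, congruence r -> (forall x y, S x y -> r x y) -> r u v.

Lemma gen_cong_congruence S : congruence (gen_cong S).
Proof.
split.
- by move=> u r [].
- by move=> u v uv r rc Sr; apply: (cong_sym rc); apply: uv.
- move=> u v w uv vw r rc Sr.
  by apply: (cong_trans rc (v := v)); [apply: uv | apply: vw].
- move=> u u' v v' uu' vv' r rc Sr.
  by apply: (cong_add rc); [apply: uu' | apply: vv'].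
- by move=> a u v uv r rc Sr; apply: (cong_scale rc); apply: uv.
Qed.

Variable S : V -> V -> Prop.

Definition gen_congb : rel V := fun u v => `[< gen_cong S u v >].

Fact gen_congb_refl : reflexive gen_congb.
Proof. by move=> u; apply/asboolP; exact: (cong_refl (gen_cong_congruence S)). Qed.

Fact gen_congb_sym : symmetric gen_congb.
Proof.
by move=> u v; apply/asboolP/asboolP; apply: (cong_sym (gen_cong_congruence S)).
Qed.

Fact gen_congb_trans : transitive gen_congb.
Proof.
move=> v u w /asboolP uv /asboolP vw; apply/asboolP.
exact: (cong_trans (gen_cong_congruence S) uv vw).
Qed.

Canonical gen_congb_equiv :=
  EquivRel gen_congb gen_congb_refl gen_congb_sym gen_congb_trans.

Definition quot_mod : Type := {eq_quot gen_congb}.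

HB.instance Definition _ := EqQuotient.on quot_mod.
HB.instance Definition _ := Choice.on quot_mod.

Definition quot_pi (u : V) : quot_mod := \pi_(quot_mod) u.

Lemma quot_piP u v : quot_pi u = quot_pi v <-> gen_cong S u v.
Proof.
rewrite /quot_pi; split=> [/eqquotP|uv].
  by rewrite /gen_congb => /asboolP.
by apply/eqquotP; rewrite /gen_congb; apply/asboolP.
Qed.

Lemma quot_piK (p : quot_mod) : quot_pi (repr p) = p.
Proof. exact: reprK. Qed.

Definition quot_add (p q : quot_mod) : quot_mod := quot_pi (repr p + repr q).
Definition quot_scale (a : K) (p : quot_mod) : quot_mod :=
  quot_pi (a *: repr p).

Lemma quot_addE u v : quot_add (quot_pi u) (quot_pi v) = quot_pi (u + v).
Proof.
apply/quot_piP; apply: (cong_add (gen_cong_congruence S));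
  by apply/quot_piP; apply: quot_piK.
Qed.

Lemma quot_scaleE a u : quot_scale a (quot_pi u) = quot_pi (a *: u).
Proof.
apply/quot_piP; apply: (cong_scale (gen_cong_congruence S));
  by apply/quot_piP; apply: quot_piK.
Qed.

Fact quot_addA : associative quot_add.
Proof.
move=> p q r; rewrite -(quot_piK p) -(quot_piK q) -(quot_piK r).
by rewrite !quot_addE addrA.
Qed.

Fact quot_addC : commutative quot_add.
Proof.
by move=> p q; rewrite -(quot_piK p) -(quot_piK q) !quot_addE addrC.
Qed.

Fact quot_add0 : left_id (quot_pi 0) quot_add.
Proof. by move=> p; rewrite -(quot_piK p) quot_addE add0r. Qed.

HB.instance Definition _ :=
  GRing.isNmodule.Build quot_mod quot_addA quot_addC quot_add0.

Fact quot_scalerA a b p : quot_scale a (quot_scale b p) = quot_scale (a * b) p.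
Proof. by rewrite -(quot_piK p) !quot_scaleE scalerA. Qed.

Fact quot_scale0r p : quot_scale 0 p = 0.
Proof. by rewrite -(quot_piK p) quot_scaleE scale0r. Qed.

Fact quot_scale1r : left_id 1 quot_scale.
Proof. by move=> p; rewrite -(quot_piK p) quot_scaleE scale1r. Qed.

Fact quot_scalerDr : right_distributive quot_scale +%R.
Proof.
move=> a p q; rewrite -(quot_piK p) -(quot_piK q).
by rewrite -![_ + _]/(quot_add _ _) !(quot_addE, quot_scaleE) scalerDr.
Qed.

Fact quot_scalerDl p : {morph quot_scale^~ p : a b / a + b}.
Proof.
move=> a b; rewrite -(quot_piK p) -[RHS]/(quot_add _ _).
by rewrite !quot_scaleE quot_addE scalerDl.
Qed.

HB.instance Definition _ := GRing.Nmodule_isLSemiModule.Build K quot_mod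
  quot_scalerA quot_scale0r quot_scale1r quot_scalerDr quot_scalerDl.

End QuotientModule.

Definition isomorphic (K : pzSemiRingType) (N N' : lSemiModType K) : Prop :=
  exists f : {linear N -> N'}, bijective f.

Definition finitely_generated (K : pzSemiRingType) (N : lSemiModType K) : Prop :=
  exists (n : nat) (g : 'I_n -> N),
    forall x : N, exists a : 'I_n -> K, x = \sum_i a i *: g i.

Definition supp (R : realType) (E : finType) (X : {ffun E -> Rmax R}) : {set E} :=
  [set e | X e != 0]%SET.

Record valuated_matroid (R : realType) (E : finType) := ValuatedMatroid {
  circuit : {ffun E -> Rmax R} -> Prop;
  circuit_neq0 : ~ circuit 0;
  circuit_incomp : forall X Y, circuit X -> circuit Y ->
    supp X <> supp Y -> ~~ (supp X \subset supp Y);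
  circuit_scale : forall X (a : Rmax R), circuit X -> a != 0 -> circuit (a *: X);
  circuit_elim : forall X Y (u v : E), circuit X -> circuit Y ->
    X u = Y u -> X u != 0 -> Y v < X v ->
    exists Z, [/\ circuit Z, Z u = 0, Z v = X v &
      forall e, Z e <= Order.max (X e) (Y e)]
}.

Definition simple_vmatroid (R : realType) (E : finType) (M : valuated_matroid R E) : Prop :=
  forall X, circuit M X -> (3 <= #|supp X|)%N.

Definition proj_equiv (R : realType) (E E' : finType)
    (M : valuated_matroid R E) (M' : valuated_matroid R E') : Prop :=
  exists (phi : E -> E') (phi_inv : E' -> E) (s : E -> Rmax R),
    [/\ cancel phi phi_inv, cancel phi_inv phi, forall e, s e != 0 &
      forall eta : {ffun E -> Rmax R},
        circuit M eta <->
        circuit M' [ffun y => s (phi_inv y) * eta (phi_inv y)]].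

Definition basis_elt (R : realType) (E : finType) (e : E) : {ffun E -> Rmax R} :=
  [ffun y => if y == e then 1 else 0].

Definition bend (R : realType) (E : finType) (M : valuated_matroid R E)
    (u v : {ffun E -> Rmax R}) : Prop :=
  exists (c : {ffun E -> Rmax R}) (x : E),
    [/\ circuit M c, u = \sum_(y : E) c y *: basis_elt R y &
      v = \sum_(y : E | y != x) c y *: basis_elt R y].

Definition bend_module (R : realType) (E : finType) (M : valuated_matroid R E) :
    lSemiModType (Rmax R) :=
  quot_mod (bend M).

Section Geometric.
Variables (R : realType) (N : lSemiModType (Rmax R)).
Implicit Types x y z : N.

Definition mle x y : Prop := x + y = y.

Definition calO : set (Rmax R) := [set a : Rmax R | a <= 1]%classic.

Definition mle_itv x y : set N := [set z | mle x z /\ mle z y]%classic.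

Definition weakly_covers x y : Prop :=
  mle x y /\ forall z, mle_itv x y z -> exists2 a, calO a & z = x + a *: y.

Definition covers x y : Prop :=
  mle x y /\ set_bij calO (mle_itv x y) (fun a => x + a *: y).

Definition atom x : Prop := covers 0 x.

Definition atomic : Prop :=
  forall x, exists2 s : seq N, (forall t, t \in s -> atom t) &
    x = \sum_(t <- s) t.

Definition semimodular : Prop :=
  forall x y z, weakly_covers x y -> weakly_covers (x + z) (y + z).

Definition strongly_torsion_free : Prop :=
  (forall x (a : Rmax R), x != 0 -> a != 0 -> a *: x != 0) /\
  (forall x y (a b : Rmax R), mle x y -> calO a -> calO b ->
     x + a *: y = x + b *: y ->
     a = b \/ (x = x + a *: y /\ x + a *: y = x + b *: y)).

Definition geometric : Prop :=
  [/\ atomic, semimodular & strongly_torsion_free].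

End Geometric.

(* Main.v *)
Require Import Defs.
From HB Require Import structures.
From mathcomp Require Import all_boot all_order all_algebra.
From mathcomp Require Import boolp classical_sets functions reals.

(** In [Q_M], a multiple [a e] of a generator lies below the class of [v] iff
    [a <= v e] or some circuit [c] with [c e = a] lies below [v] away from [e]:
    circuit elimination makes this relation transitive, hence a congruence.
    Semimodularity, torsion-freeness and (for [M] simple) the description of the
    atoms as the multiples of the generators can then be read off. The circuits
    are recovered from [Q_M] as the functions of minimal nonempty support among
    those whose bend relations hold in [Q_M], and an isomorphism permutes the
    lines of atoms, which yields a projective equivalence.

    Conversely, let [E] consist of one atom on each line in a finitely generated
    geometric module [N], and call circuits the functions of minimal nonempty
    support whose bend relations hold in [N]. If [a e <= x + b e] with [b < a],
    torsion-freeness gives [a e <= x]; this turns substitution of one relation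
    into another into circuit elimination. Semimodularity gives the exchange of
    atoms needed to shrink any inequality [a e <= \sum_y u(y) y] to one carried
    by a circuit, so that the bend relations of the circuits present [N]. *)

Set Implicit Arguments.
Unset Strict Implicit.
Unset Printing Implicit Defensive.

Import Order.TTheory GRing.Theory.
Local Open Scope ring_scope.

(** * The semifield [Rmax] *)

Section RmaxOrder.
Variable R : realType.
Implicit Types x y z a b : Rmax R.

Definition Rmax_inv x : Rmax R := if x is Some r then Some (- r) else None.

Lemma Rmax_addE x y : x + y = Order.max x y :> Rmax R.
Proof.
case: leP => [|/ltW]; rewrite Rmax_leE => /eqP //.
by rewrite addrC.
Qed.

Lemma Rmax_ge0 x : 0 <= x :> Rmax R.
Proof. by rewrite Rmax_leE add0r. Qed.

Lemma Rmax_le0 x : (x <= 0) = (x == 0).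
Proof. by rewrite Rmax_leE addr0. Qed.

Lemma Rmax_gt0 x : (0 < x :> Rmax R) = (x != 0).
Proof. by rewrite lt_def Rmax_ge0 andbT. Qed.

Lemma Rmax_leDl x y : x <= x + y.
Proof. by rewrite Rmax_addE le_max lexx. Qed.

Lemma Rmax_leDr x y : y <= x + y.
Proof. by rewrite addrC Rmax_leDl. Qed.

Lemma Rmax_geD x y z : (x + y <= z :> Rmax R) = (x <= z) && (y <= z).
Proof. by rewrite Rmax_addE ge_max. Qed.

Lemma Rmax_leM2l a x y : x <= y -> a * x <= a * y :> Rmax R.
Proof. by rewrite !Rmax_leE -mulrDr => /eqP ->. Qed.

Lemma Rmax_leM2r a x y : x <= y -> x * a <= y * a :> Rmax R.
Proof. by rewrite ![_ * a]mulrC; apply: Rmax_leM2l. Qed.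

Lemma Rmax_mulVx x : x != 0 -> Rmax_inv x * x = 1.
Proof.
case: x => [r|] // _.
by rewrite -[LHS]/(Some (- r + r)) addNr.
Qed.

Lemma Rmax_inv_neq0 x : x != 0 -> Rmax_inv x != 0.
Proof. by case: x. Qed.

Lemma Rmax_mulKx x y : x != 0 -> Rmax_inv x * (x * y) = y.
Proof. by move=> x0; rewrite mulrA Rmax_mulVx ?mul1r. Qed.

Lemma Rmax_mulVKx x y : x != 0 -> x * (Rmax_inv x * y) = y.
Proof. by move=> x0; rewrite mulrCA Rmax_mulKx. Qed.

Lemma Rmax_leM2lE a x y :
  a != 0 -> (a * x <= a * y :> Rmax R) = (x <= y).
Proof.
move=> a0; apply/idP/idP; last exact: Rmax_leM2l.
by move/(Rmax_leM2l (Rmax_inv a)); rewrite !Rmax_mulKx.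
Qed.

Lemma Rmax_mul_eq0 x y : (x * y == 0) = (x == 0) || (y == 0).
Proof. by case: x y => [r|] [s|]. Qed.

Lemma Rmax_sum_attained (I : finType) (b : I -> Rmax R) :
  \sum_i b i = 0 \/ exists i, \sum_i b i = b i.
Proof.
elim/big_ind: _ => [|x y|i _]; [by left | | by right; exists i].
move=> Hx Hy; case: (leP x y) => [|/ltW]; rewrite Rmax_leE; last rewrite addrC.
  by move/eqP->.
by move/eqP->.
Qed.

Lemma Rmax_sum_le (I : finType) (b : I -> Rmax R) a :
  (forall i, b i <= a) -> \sum_i b i <= a :> Rmax R.
Proof.
move=> ba; elim/big_ind: _ => [|x y xa ya|i _]; rewrite ?Rmax_ge0 ?Rmax_geD //.
by rewrite xa.
Qed.

(** Take for [k] the least ratio [c f / d f] over the support of [d]; it is nonzero because that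
    support lies in the support of [c]. The multiple [k d] then touches [c] from below. *)
Lemma Rmax_max_scaling (E : finType) (c d : {ffun E -> Rmax R}) :
  d != 0 -> (forall e, c e = 0 -> d e = 0) ->
  exists2 k, k != 0 &
    (forall e, k * d e <= c e :> Rmax R) /\ exists2 f, d f != 0 & k * d f = c f.
Proof.
move=> dn0 cd.
have [f0 df0] : exists f0, d f0 != 0.
  apply: contrapT => d0; case/eqP: dn0; apply/ffunP => e; rewrite ffunE.
  by apply: contrapT => /eqP de; apply: d0; exists e.
case: (@arg_minP _ (Rmax R) E f0 (fun f => d f != 0)
  (fun f => c f * Rmax_inv (d f)) df0) => f df fmin.
have cf : c f != 0 by apply: contra_neq df; apply: cd.
exists (c f * Rmax_inv (d f)).
  by rewrite Rmax_mul_eq0 negb_or cf Rmax_inv_neq0.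
split=> [e|]; last by exists f; rewrite // -mulrA Rmax_mulVx ?mulr1.
case: (eqVneq (d e) 0) => [->|de]; first by rewrite mulr0 Rmax_ge0.
have := Rmax_leM2r (d e) (fmin e de).
by rewrite -[X in _ <= X]mulrA Rmax_mulVx ?mulr1.
Qed.

End RmaxOrder.

(** * Modules over [Rmax] *)

Section ModuleOrder.
Variables (R : realType) (N : lSemiModType (Rmax R)).
Implicit Types (x y z : N) (a b : Rmax R).

Lemma mle_refl x : mle x x.
Proof.
rewrite /mle -{1 2}[x]scale1r -scalerDl.
have /eqP -> : 1 + 1 == 1 :> Rmax R by rewrite -Rmax_leE.
by rewrite scale1r.
Qed.
Hint Resolve mle_refl : core.

Lemma mle_trans y x z : mle x y -> mle y z -> mle x z.
Proof. by rewrite /mle => xy yz; rewrite -yz addrA xy. Qed.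

Lemma mle_anti x y : mle x y -> mle y x -> x = y.
Proof. by rewrite /mle => xy; rewrite addrC xy. Qed.

Lemma mle0 x : mle 0 x.
Proof. by rewrite /mle add0r. Qed.
Hint Resolve mle0 : core.

Lemma mle_le0 x : mle x 0 -> x = 0.
Proof. by rewrite /mle addr0. Qed.

Lemma mleDl x y : mle x (x + y).
Proof. by rewrite /mle addrA mle_refl. Qed.
Hint Resolve mleDl : core.

Lemma mleDr x y : mle y (x + y).
Proof. by rewrite addrC. Qed.
Hint Resolve mleDr : core.

Lemma mle_lub x y z : mle x z -> mle y z -> mle (x + y) z.
Proof. by rewrite /mle => xz yz; rewrite -addrA yz. Qed.

Lemma mleD x x' y y' : mle x x' -> mle y y' -> mle (x + y) (x' + y').
Proof.
move=> xx' yy'; apply: mle_lub.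
  by apply: mle_trans xx' _.
by apply: mle_trans yy' _.
Qed.

Lemma mleZ a x y : mle x y -> mle (a *: x) (a *: y).
Proof. by rewrite /mle -scalerDr => ->. Qed.

Lemma mleZl a b x : a <= b -> mle (a *: x) (b *: x).
Proof. by rewrite Rmax_leE /mle -scalerDl => /eqP ->. Qed.

Lemma mle_sumP (I : finType) (F : I -> N) z :
  mle (\sum_i F i) z <-> forall i, mle (F i) z.
Proof.
split=> [Fz i|Fz]; first by apply: mle_trans Fz; rewrite (bigD1 i) //=.
by apply: (big_ind (fun w => mle w z)) => // x y; apply: mle_lub.
Qed.

Lemma scale_invK a x : a != 0 -> Rmax_inv a *: (a *: x) = x.
Proof. by move=> a0; rewrite scalerA Rmax_mulVx // scale1r. Qed.

Lemma scale_Kinv a x : a != 0 -> a *: (Rmax_inv a *: x) = x.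
Proof. by move=> a0; rewrite scalerA mulrC Rmax_mulVx // scale1r. Qed.

Lemma scale_neq0 a x : a != 0 -> x != 0 -> a *: x != 0.
Proof.
by move=> a0; apply: contra_neq => ax; rewrite -(scale_invK x a0) ax scaler0.
Qed.

Lemma atomP x : atom x <->
  (forall z, mle z x -> exists2 a : Rmax R, a <= 1 & z = a *: x) /\
  (forall a b : Rmax R, a <= 1 -> b <= 1 -> a *: x = b *: x -> a = b).
Proof.
rewrite /atom /covers /set_bij /set_inj /set_surj; split.
  case=> _ [_ inj surj]; split=> [z zx|a b a1 b1 ab].
    have [a a1 <-] := surj z (conj (mle0 z) zx).
    by exists a; rewrite ?add0r.
  by apply: inj; rewrite ?inE ?add0r.
case=> surj inj; split=> //; split=> [a a1|a b|z [_ /surj[a a1 ->]]].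
- by split=> //; rewrite add0r -{2}[x]scale1r; apply: mleZl.
- by rewrite !inE !add0r; apply: inj.
- by exists a; rewrite ?add0r.
Qed.

Lemma atom_neq0 x : atom x -> x != 0.
Proof.
case/atomP=> _ inj; apply/eqP => x0.
by have := inj 0 1 (Rmax_ge0 _) (lexx _); rewrite x0 !scaler0 => /(_ erefl).
Qed.

Lemma atomZ a x : a != 0 -> atom x -> atom (a *: x).
Proof.
move=> a0 /atomP[surj inj]; apply/atomP; split=> [z zx|b c b1 c1].
  have /surj[b b1 zE] : mle (Rmax_inv a *: z) x.
    by rewrite -(scale_invK x a0); apply: mleZ.
  by exists b; rewrite // scalerA mulrC -scalerA -zE scale_Kinv.
rewrite !scalerA ![_ * a]mulrC -!scalerA => /(congr1 ( *:%R (Rmax_inv a))).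
by rewrite !scale_invK //; apply: inj.
Qed.

(* Equivalent to part (ii) of strong torsion-freeness (strongly_torsion_freeP),
   but, unlike (ii), stable under sums in [y]. *)
Definition cancellable y :=
  forall x a b, a < b -> mle (b *: y) (x + a *: y) -> mle (b *: y) x.

(** Cancelling [y'] against [x + a y] gives [b y' <= x + a y]. This absorbs the term [a y'], so [y]
    can be cancelled next, and [b y <= x] in turn absorbs [a y]. *)
Lemma cancellableD y y' :
  cancellable y -> cancellable y' -> cancellable (y + y').
Proof.
move=> Hy Hy' x a b ab; rewrite !scalerDr => le.
have le' : mle (b *: y') (x + a *: y).
  by apply: (Hy' _ a) => //; rewrite -addrA; apply: mle_trans le.
have yx : mle (b *: y) x.
  apply: (Hy _ a) => //; apply: mle_trans (mleDl _ _) (mle_trans le _).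
  rewrite addrA; apply: mle_lub => //; apply: mle_trans le'.
  exact/mleZl/ltW.
apply: mle_lub => //; apply: mle_trans le' _; apply: mle_lub => //.
by apply: mle_trans yx; apply/mleZl/ltW.
Qed.

Lemma cancellable0 : cancellable 0.
Proof. by move=> x a b _ _; rewrite scaler0. Qed.

Lemma cancellableZ a y : cancellable y -> cancellable (a *: y).
Proof.
case: (eqVneq a 0) => [-> _|a0 Hy x b c bc].
  by rewrite scale0r; apply: cancellable0.
rewrite !scalerA; apply: Hy; rewrite lt_neqAle Rmax_leM2r ?ltW // andbT.
apply: contra_ltN bc => /eqP; rewrite ![_ * a]mulrC.
by move=> /(congr1 ( *%R (Rmax_inv a))); rewrite !Rmax_mulKx // => ->.
Qed.

(** Forward, apply (ii) to [x <= x + b y] with the coefficients [a / b] and 1, which differ since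
    [a < b]. Backward, in [x + a y = x + b y] cancellation puts the term with the larger coefficient
    below [x], so both sides equal [x]. *)
Lemma strongly_torsion_freeP :
  strongly_torsion_free N <-> forall y, cancellable y.
Proof.
split=> [[_ stf] y x a b ab le|canc].
  have b0 : b != 0 by rewrite -Rmax_gt0; apply: le_lt_trans ab; apply: Rmax_ge0.
  pose k := Rmax_inv b * a.
  have kb : k * b = a by rewrite /k mulrAC Rmax_mulVx ?mul1r.
  have k1 : k <= 1 by rewrite -(Rmax_mulVx b0); apply/Rmax_leM2l/ltW.
  have xk : x + k *: (x + b *: y) = x + a *: y.
    rewrite scalerDr scalerA kb addrA; congr (_ + _).
    rewrite addrC; apply: mle_anti; last exact: mleDr.
    by apply: mle_lub => //; rewrite -{2}[x]scale1r; apply: mleZl.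
  have ->: x = x + b *: y; last exact: mleDr.
  case: (stf x (x + b *: y) k 1) => //; first by rewrite /calO /= lexx.
  - rewrite xk scale1r; apply: mle_anti.
      apply: mle_lub => //; apply: mle_trans (mleDr x _).
      by apply: mle_trans (mleDr x _); apply/mleZl/ltW.
    by apply: mle_lub => //; apply: mle_lub.
  - by move=> k1E; move: ab; rewrite -kb k1E mul1r ltxx.
  - by case=> E1 E2; rewrite {1}E1 E2 scale1r addrA [x + x]mle_refl.
split=> [x a x0 a0|x y a b _ _ _ E]; first exact: scale_neq0.
case: (ltgtP a b) => [ab|ba|]; [right|right|by left].
  have byx : mle (b *: y) x by apply: (canc y x a b ab); rewrite E.
  by rewrite E addrC byx.
have ayx : mle (a *: y) x by apply: (canc y x b a ba); rewrite -E.
by rewrite -E addrC ayx.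
Qed.

(** A multiple of an atom weakly covers 0, and adding [x] preserves this. The resulting form
    [x + a (x + b y)] is [x + (a b) y], as [a x <= x]. *)
Lemma semimodular_exchange x y z b :
  semimodular N -> atom y -> mle x z -> mle z (x + b *: y) ->
  exists2 a, a <= b & z = x + a *: y.
Proof.
move=> smod yat xz zy.
have wc : weakly_covers 0 (b *: y).
  case: (eqVneq b 0) => [->|b0].
    split=> // w [_]; rewrite scale0r => /mle_le0 ->.
    by exists 0; rewrite ?scaler0 ?addr0 // /calO /= Rmax_ge0.
  case/(atomZ b0)/atomP: yat => surj _; split=> // w [_ /surj[a a1 ->]].
  by exists a; rewrite ?add0r.
case: (smod _ _ x wc) => _; rewrite add0r addrC => /(_ z (conj xz zy))[a a1 ->].
have a1' : a <= 1 by [].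
exists (a * b); first by rewrite -{2}[b]mul1r Rmax_leM2r.
rewrite scalerDr addrA scalerA; congr (_ + _); rewrite addrC.
by rewrite -{2 3}[x]scale1r; apply: mleZl.
Qed.

End ModuleOrder.

#[global] Hint Resolve mle_refl mle0 mleDl mleDr : core.

Lemma exists_minimizer (T : Type) (P : T -> Prop) (m : T -> nat) :
  (exists x, P x) -> exists2 x, P x & forall y, P y -> (m x <= m y)%N.
Proof.
case=> x Px.
have ex : exists n, `[< exists2 y, P y & m y = n >].
  by exists (m x); apply/asboolP; exists x.
case: (ex_minnP ex) => n /asboolP[y Py <-] ymin.
by exists y => // z Pz; apply: ymin; apply/asboolP; exists z.
Qed.

(** * Linear combinations of a finite family and their bend relations *)

Section Combinations.
Variables (R : realType) (E : finType).
Implicit Types (u v w c d : {ffun E -> Rmax R}) (e f : E) (a b : Rmax R).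

Definition del u e : {ffun E -> Rmax R} :=
  [ffun y => if y == e then 0 else u y].

Lemma del_le u e f : del u e f <= u f.
Proof. by rewrite ffunE; case: ifP => // _; apply: Rmax_ge0. Qed.

Lemma del_eq u e : del u e e = 0.
Proof. by rewrite ffunE eqxx. Qed.

Lemma del_neq u e f : f != e -> del u e f = u f.
Proof. by rewrite ffunE => /negPf->. Qed.

Lemma delZ a u e : del (a *: u) e = a *: del u e.
Proof.
by apply/ffunP => y; rewrite !ffunE; case: ifP => // _; rewrite scaler0.
Qed.

Lemma ffun_neq0P u : u != 0 <-> exists e, u e != 0.
Proof.
split=> [u0|[e ue]]; last by apply: contra_neq ue => ->; rewrite ffunE.
apply: contrapT => Hu; case/eqP: u0; apply/ffunP => e; rewrite ffunE.
by apply: contrapT => /eqP ue; apply: Hu; exists e.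
Qed.

Variables (N : lSemiModType (Rmax R)) (g : E -> N).

Definition comb u : N := \sum_e u e *: g e.

Lemma comb0 : comb 0 = 0.
Proof. by rewrite /comb big1 // => e _; rewrite ffunE scale0r. Qed.

Lemma combD u v : comb (u + v) = comb u + comb v.
Proof.
by rewrite /comb -big_split; apply: eq_bigr => e _; rewrite ffunE scalerDl.
Qed.

Lemma combZ a u : comb (a *: u) = a *: comb u.
Proof.
by rewrite /comb scaler_sumr; apply: eq_bigr => e _; rewrite ffunE scalerA.
Qed.

Lemma comb_basis e : comb (basis_elt R e) = g e.
Proof.
rewrite /comb (bigD1 e) //= big1 => [|f fe]; rewrite ffunE ?eqxx.
  by rewrite scale1r addr0.
by rewrite (negPf fe) scale0r.
Qed.

Lemma comb_leP u z : mle (comb u) z <-> forall e, mle (u e *: g e) z.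
Proof. exact: mle_sumP. Qed.

Lemma comb_ge u e : mle (u e *: g e) (comb u).
Proof. by apply/comb_leP: e; apply: mle_refl. Qed.

Lemma comb_mono u v : (forall e, u e <= v e) -> mle (comb u) (comb v).
Proof.
move=> uv; apply/comb_leP => e; apply: mle_trans (comb_ge v e).
exact: mleZl.
Qed.

Lemma comb_del u e : comb u = comb (del u e) + u e *: g e.
Proof.
apply: mle_anti.
  apply/comb_leP => f; case: (eqVneq f e) => [->|fe]; first exact: mleDr.
  by apply: mle_trans (mleDl _ _); rewrite -(del_neq u fe); apply: comb_ge.
apply: mle_lub (comb_ge u e); exact/comb_mono/del_le.
Qed.

(** Idempotency allows the terms of a combination to be compared with multiples of [y] one at a time
    modulo [x]. This reduces questions about weak covers to single generators. *)
Lemma comb_add_scale x y u (b : E -> Rmax R) :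
  (forall e, x + u e *: g e = x + b e *: y) ->
  x + comb u = x + (\sum_e b e) *: y.
Proof.
move=> ub; rewrite scaler_suml; apply: mle_anti; apply: mle_lub => //.
  apply/comb_leP => e; apply: mle_trans (mleDr x _) _; rewrite ub.
  by apply: mleD => //; apply/mle_sumP: e; apply: mle_refl.
apply/mle_sumP => e; apply: mle_trans (mleDr x _) _; rewrite -ub.
by apply: mleD => //; apply: comb_ge.
Qed.

(* All bend relations of [c] hold in [N]; when [N] is the bend module of [M],
   these are the tropical linear combinations of circuits of [M]. *)
Definition vector c := forall e, mle (c e *: g e) (comb (del c e)).

Definition min_vector c := [/\ c != 0, vector c &
  forall d, d != 0 -> vector d -> (forall e, c e = 0 -> d e = 0) ->
    forall e, d e = 0 -> c e = 0].

Lemma vectorZ a c : vector c -> vector (a *: c).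
Proof.
by move=> cv e; rewrite delZ combZ ffunE -scalerA; apply/mleZ/cv.
Qed.

Lemma min_vectorZ a c : a != 0 -> min_vector c -> min_vector (a *: c).
Proof.
move=> a0 [c0 cv cmin]; split; [exact: scale_neq0|exact: vectorZ|].
move=> d d0 dv cd e de; rewrite ffunE (cmin d) ?scaler0 // => f cf.
by apply: cd; rewrite ffunE cf scaler0.
Qed.

(** Substitute the bend relation of [d] at [f] into that of [c] at [e]. The term [d e *: g e] that
    this creates on the right has a smaller coefficient than [c e], so it can be cancelled. *)
Lemma vector_elim c d e f : (forall y : N, cancellable y) ->
  vector c -> vector d -> c f = d f -> d e < c e ->
  mle (c e *: g e) (comb (del (del (c + d) e) f)).
Proof.
move=> canc cv dv cdf cde; apply: (canc _ _ (d e)) => //.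
apply: mle_trans (cv e) _; apply/comb_leP => y.
set m := del _ f; rewrite ffunE; case: (eqVneq y e) => [_|ye].
  by rewrite scale0r.
have mE z : z != e -> z != f -> m z = c z + d z.
  by move=> ze zf; rewrite !del_neq // ffunE.
case: (eqVneq y f) => [yf|yf]; last first.
  apply: mle_trans (mleDl _ _); apply: mle_trans (comb_ge m y).
  by apply: mleZl; rewrite mE // Rmax_leDl.
rewrite yf cdf; apply: mle_trans (dv f) _; apply/comb_leP => z.
case: (eqVneq z f) => [->|zf]; first by rewrite del_eq scale0r.
rewrite del_neq //; case: (eqVneq z e) => [->|ze]; first exact: mleDr.
apply: mle_trans (mleDl _ _); apply: mle_trans (comb_ge m z).
by apply: mleZl; rewrite mE // Rmax_leDr.
Qed.

End Combinations.

(** * Circuits from families of atoms *)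

Section GeometricFamily.
Variables (R : realType) (N : lSemiModType (Rmax R)) (E : finType) (g : E -> N).
Hypotheses (smod : semimodular N) (canc : forall y : N, cancellable y).
Hypothesis g_atom : forall e, atom (g e).
Implicit Types (u v w c d : {ffun E -> Rmax R}) (e f : E) (a b : Rmax R).
Local Notation comb := (comb g).

(* Among the [v] of minimal support, semimodularity lets one lower the [y]-th
   coefficient until exchanging [y] with [e]; cancellation shows that this
   preserves the tightness already achieved at other elements. *)
Lemma exists_tight u e a : mle (a *: g e) (comb u) ->
  exists v, [/\ forall y, v y <= u y, mle (a *: g e) (comb v),
    forall w y, (forall z, w z <= v z) -> w y = 0 -> v y != 0 ->
      ~ mle (a *: g e) (comb w) &
    forall y, mle (v y *: g y) (comb (del v y) + a *: g e)].
Proof.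
move=> au; pose P v := (forall y, v y <= u y) /\ mle (a *: g e) (comb v).
pose minimal v := forall w y, (forall z, w z <= v z) -> w y = 0 ->
  v y != 0 -> ~ mle (a *: g e) (comb w).
have [v0 [v0u av0] v0min] : exists2 v, P v & minimal v.
  have [v [vu av] vmin] : exists2 v, P v &
      forall w, P w -> (#|supp v| <= #|supp w|)%N.
    by apply: exists_minimizer; exists u; split.
  exists v => // w y wv wy vy aw.
  have: P w by split=> // z; apply: le_trans (vu z).
  move/vmin; apply/negP; rewrite -ltnNge; apply: proper_card.
  apply/properP; split; last by exists y; rewrite inE ?wy ?eqxx.
  apply/fintype.subsetP => z; rewrite !inE -!Rmax_gt0 => wz.
  exact: lt_le_trans (wv z).
pose tight v y := mle (v y *: g y) (comb (del v y) + a *: g e).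
(* Among the support-minimal candidates, choose one with the fewest non-tight elements. *)
have [v [[vu av] vmin] vtight] : exists2 v, P v /\ minimal v & forall w,
    P w /\ minimal w ->
    (#|[set y | ~~ `[< tight v y >]]%SET| <=
     #|[set y | ~~ `[< tight w y >]]%SET|)%N.
  by apply: exists_minimizer; exists v0.
exists v; split=> // y; apply: contrapT => ny.
(* If [y] is not tight, lowering its coefficient to [b] makes it tight. The new candidate [v'] will
   have strictly fewer non-tight elements. *)
have [||b bv bE] := @semimodular_exchange _ _ (comb (del v y)) (g y)
    (comb (del v y) + a *: g e) (v y) smod (g_atom y).
- exact: mleDl.
- by rewrite -comb_del; apply: mle_lub => //; apply/comb_mono/del_le.
pose v' : {ffun E -> Rmax R} := [ffun z => if z == y then b else v z].
have v'v z : v' z <= v z by rewrite ffunE; case: eqP => [->|].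
have delv' : del v' y = del v y.
  by apply/ffunP => z; rewrite !ffunE; case: eqP.
have v'y : v' y = b by rewrite ffunE eqxx.
have v'E : comb v' = comb (del v y) + a *: g e.
  by rewrite (comb_del _ _ y) delv' v'y bE.
have v'min : minimal v'.
  move=> w z wv' wz v'z; apply: (vmin _ z) => // [x|].
    exact: le_trans (wv' x) (v'v x).
  by move: v'z; rewrite -!Rmax_gt0 => /lt_le_trans; apply.
have av' : mle (a *: g e) (comb v') by rewrite v'E; apply: mleDr.
have v'P : P v' by split=> // z; apply: le_trans (v'v z) (vu z).
have := vtight v' (conj v'P v'min); apply/negP; rewrite -ltnNge.
apply: proper_card; apply/properP; split; last first.
  exists y; rewrite inE; first by apply/negP => /asboolP.
  rewrite negbK; apply/asboolP; rewrite /tight delv' -v'E.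
  exact: comb_ge.
apply/fintype.subsetP => z; rewrite !inE; apply: contra => /asboolP tz.
apply/asboolP.
have [->|zy] := eqVneq z y; first by rewrite /tight delv' -v'E; apply: comb_ge.
have v'z : v' z = v z by rewrite ffunE (negPf zy).
have [vz0|vz0] := eqVneq (v z) 0; first by rewrite /tight v'z vz0 scale0r.
(* The same exchange at [z] tests whether [z] stays tight: it does if [b2 = v' z]. *)
have [||b2 b2v b2E] := @semimodular_exchange _ _ (comb (del v' z)) (g z)
    (comb (del v' z) + a *: g e) (v' z) smod (g_atom z).
- exact: mleDl.
- by rewrite -comb_del; apply: mle_lub => //; apply/comb_mono/del_le.
rewrite /tight b2E; move: b2v; rewrite le_eqVlt => /orP[/eqP <-|b2v].
  exact: mleDr.
(* If [b2 < v z], the tightness of [v] at [z] bounds [v z *: g z] by [comb (del v z) + b2 *: g z].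
   Cancellation makes the [z]-term of [v] redundant, against minimality of the support. *)
exfalso; apply: (vmin (del v z) z) => //; first exact: del_le.
  exact: del_eq.
have vz : mle (v z *: g z) (comb (del v z)).
  apply: (canc (a := b2)); first by rewrite -v'z.
  apply: mle_trans tz _; apply: mle_lub => //.
  apply: (mle_trans (mleDr (comb (del v' z)) _)); rewrite b2E.
  apply: mleD => //; apply: comb_mono => x; rewrite !ffunE.
  by case: ifP => // _; have := v'v x; rewrite ffunE.
by apply: mle_trans av _; rewrite (comb_del _ v z); apply: mle_lub.
Qed.

(** Cancel the [e]-term of [u], pass to a tight support-minimal [v], and put [a] at [e]: tightness
    gives the bend relations, and minimality of [v] gives that of the new vector. *)
Lemma min_vector_through u e a : mle (a *: g e) (comb u) -> u e < a ->
  exists2 c, min_vector g c & c e = a /\ forall y, y != e -> c y <= u y.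
Proof.
move=> au uea.
have {}au : mle (a *: g e) (comb (del u e)).
  by apply: (canc (a := u e)); rewrite -?comb_del.
have [v [vu av vmin vtight]] := exists_tight au.
have ve : v e = 0 by apply/eqP; rewrite -Rmax_le0 -(del_eq u e).
have a0 : a != 0.
  by rewrite -Rmax_gt0; apply: le_lt_trans uea; apply: Rmax_ge0.
pose c : {ffun E -> Rmax R} := [ffun y => if y == e then a else v y].
have ce : c e = a by rewrite ffunE eqxx.
have cy y : y != e -> c y = v y by rewrite ffunE => /negPf->.
have delc : del c e = v.
  by apply/ffunP => y; rewrite ffunE; case: eqVneq => [->|/cy].
have cv : vector g c.
  move=> y; case: (eqVneq y e) => [->|ye]; first by rewrite ce delc.
  rewrite cy //; apply: mle_trans (vtight y) _.
  (* Tightness of [v] at [y] is the bend relation of [c] at [y]. *)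
  rewrite (comb_del _ (del c y) e) del_neq 1?eq_sym // ce.
  apply: mleD => //; apply: comb_mono => x; rewrite !ffunE.
  by case: (eqVneq x e) => [->|]; rewrite // ve if_same.
exists c; last first.
  split=> // y ye; rewrite cy //.
  exact: le_trans (vu y) (del_le _ _ _).
split=> //; first by apply/ffun_neq0P; exists e; rewrite ce.
move=> d0 d00 dv0 cd0 y d0y; apply: contrapT => /eqP cy0.
(* Scale the competing vector until it touches [c] from below at some [f]. *)
have [k k0 [kc [f df cf]]] := Rmax_max_scaling d00 cd0.
pose d := k *: d0.
have dE z : d z = k * d0 z by rewrite ffunE.
have dv : vector g d by apply: vectorZ.
have dc z : d z <= c z by rewrite dE.
have dy : d y = 0 by rewrite dE d0y mulr0.
have dcf : c f = d f by rewrite dE cf.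
have df0 : d f != 0 by rewrite dE Rmax_mul_eq0 negb_or k0.
(* If [d] reaches [c] at [e], its own bend relation bounds [a *: g e] without [y]. Otherwise
   eliminating [f] between [c] and [d] bounds it without [f]. Both contradict the minimality of
   [v]. *)
move: (dc e); rewrite le_eqVlt => /orP[/eqP dce|dce].
  have ye : y != e by apply: contra_neq cy0 => ye; rewrite -dy ye dce.
  apply: (vmin (del d e) y).
  - move=> z; rewrite ffunE; case: eqVneq => [_|ze]; first exact: Rmax_ge0.
    by rewrite -(cy z).
  - by rewrite del_neq.
  - by rewrite -cy.
  - by have := dv e; rewrite dce ce.
have fe : f != e by apply: contraTneq dce => <-; rewrite dcf ltxx.
apply: (vmin (del (del (c + d) e) f) f).
- move=> z; rewrite ffunE; case: ifP => _; first exact: Rmax_ge0.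
  rewrite ffunE; case: eqVneq => [_|ze]; first exact: Rmax_ge0.
  by rewrite ffunE -(cy z) // Rmax_geD lexx dc.
- exact: del_eq.
- by rewrite -cy // dcf.
- by rewrite -{1}ce; apply: vector_elim.
Qed.

End GeometricFamily.

(** * Bend modules *)

Section BendModule.
Variables (R : realType) (E : finType) (M : valuated_matroid R E).
Implicit Types (u v w c d : {ffun E -> Rmax R}) (e f : E) (a b : Rmax R).

(** The combinatorial form of the order of the bend module; see [gen_leP]. *)
Definition dependent v e a := a <= v e \/
  exists2 c, circuit M c & c e = a /\ forall y, y != e -> c y <= v y.

Lemma dependent0 v e : dependent v e 0.
Proof. by left; apply: Rmax_ge0. Qed.

Lemma dependent_mono v w e a : (forall y, v y <= w y) ->
  dependent v e a -> dependent w e a.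
Proof.
move=> vw [ave|[c Mc [ce cv]]]; first by left; apply: le_trans (vw e).
by right; exists c => //; split=> // y ye; apply: le_trans (vw y); apply: cv.
Qed.

Lemma dependentZ v e a b : dependent v e a -> dependent (b *: v) e (b * a).
Proof.
case: (eqVneq b 0) => [->|b0]; first by rewrite mul0r => _; apply: dependent0.
case=> [ave|[c Mc [ce cv]]]; first by left; rewrite ffunE; apply: Rmax_leM2l.
right; exists (b *: c); first exact: circuit_scale.
by split=> [|y ye]; rewrite !ffunE ?ce //; apply/Rmax_leM2l/cv.
Qed.

(** Scaling a witness for [b] by [a / b <= 1] keeps it below [v]. *)
Lemma dependent_le v e a b : a <= b -> dependent v e b -> dependent v e a.
Proof.
case: (eqVneq a 0) => [-> *|a0 ab]; first exact: dependent0.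
have b0 : b != 0 by rewrite -Rmax_gt0; apply: lt_le_trans ab; rewrite Rmax_gt0.
move/(dependentZ (a * Rmax_inv b)); rewrite -mulrA Rmax_mulVx // mulr1.
apply: dependent_mono => y; rewrite ffunE -[X in _ <= X]mul1r.
by apply: Rmax_leM2r; rewrite -(Rmax_mulVx b0) mulrC; apply: Rmax_leM2l.
Qed.

(* Circuit elimination removes one by one the [y] with [c y > v y]. *)
Lemma circuit_dependent v c e : circuit M c ->
  (forall y, y != e -> dependent v y (c y)) -> dependent v e (c e).
Proof.
pose bad c := [set y | (y != e) && (v y < c y)]%SET.
have [n] := ubnP #|bad c|; elim: n c => // n IH c cn Mc cv.
have [bad0|[y]] := set_0Vmem (bad c).
  right; exists c => //; split=> // y ye; rewrite leNgt; apply/negP => vcy.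
  by have := finset.in_set0 y; rewrite -bad0 inE ye vcy.
rewrite inE => /andP[ye vcy].
have [cvy|[d Md [dy dv]]] := cv y ye; first by move: vcy; rewrite ltNge cvy.
have [cde|dce] := leP (c e) (d e).
  by left; apply: le_trans cde (dv _ _); rewrite eq_sym.
have [||Z [MZ Zy Ze Zcd]] := @circuit_elim _ _ M c d y e Mc Md _ _ dce.
- by rewrite dy.
- by rewrite -Rmax_gt0; apply: le_lt_trans vcy; apply: Rmax_ge0.
(* Since [d] lies below [v] away from [y], every bad element of [Z] is already bad for [c], while
   [y] is no longer bad. *)
have Zle z : z != e -> v z < Z z -> z != y /\ Z z <= c z.
  move=> ze vZ; have zy : z != y.
    by apply: contraTneq vZ => ->; rewrite Zy ltNge Rmax_ge0.
  split=> //; move: (Zcd z); rewrite le_max => /orP[//|Zd].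
  by move: vZ; rewrite ltNge (le_trans Zd) ?dv.
rewrite -Ze; apply: IH => //.
  rewrite -ltnS; apply: leq_trans cn; rewrite ltnS.
  apply: proper_card; apply/properP; split.
    apply/fintype.subsetP => z; rewrite !inE => /andP[ze vZ].
    have [_ Zc] := Zle z ze vZ.
    by rewrite ze; apply: lt_le_trans Zc.
  exists y; rewrite inE ?ye // negb_and orbC -leNgt Zy.
  by rewrite Rmax_ge0.
move=> z ze; have [Zv|vZ] := leP (Z z) (v z); first by left.
by have [_ Zc] := Zle z ze vZ; apply: dependent_le Zc (cv z ze).
Qed.

Lemma dependent_trans v w e a :
  (forall y, dependent w y (v y)) -> dependent v e a -> dependent w e a.
Proof.
move=> vw [ave|[c Mc [<- cv]]]; first exact: dependent_le ave (vw e).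
by apply: circuit_dependent => // y ye; apply: dependent_le (cv y ye) (vw y).
Qed.

Let below u v := forall e, dependent v e (u e).

Let below_refl u v : (forall e, u e <= v e) -> below u v.
Proof. by move=> uv e; left. Qed.

Lemma dependent_congruence : congruence (fun u v => below u v /\ below v u).
Proof.
have trans u v w : below u v -> below v w -> below u w.
  by move=> uv vw e; apply: dependent_trans (uv e).
have add u u' v v' : below u u' -> below v v' -> below (u + v) (u' + v').
  move=> uu' vv' e; rewrite ffunE Rmax_addE; case: leP => _.
    by apply: dependent_mono (vv' e) => y; rewrite ffunE Rmax_leDr.
  by apply: dependent_mono (uu' e) => y; rewrite ffunE Rmax_leDl.
have scale a u v : below u v -> below (a *: u) (a *: v).
  by move=> uv e; rewrite ffunE; apply: dependentZ.
split=> [u|u v []|u v w [uv vu] [vw wv]|u u' v v' [] ? ? [] ? ?|a u v [] ? ?] //.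
- by split; apply: below_refl.
- by split; [apply: (trans u v w)|apply: (trans w v u)].
- by split; apply: add.
- by split; apply: scale.
Qed.

Lemma sum_basis u (P : pred E) : \sum_(y | P y) u y *: basis_elt R y =
  [ffun y => if P y then u y else 0].
Proof.
apply/ffunP => e; rewrite sum_ffunE ffunE; case: ifP => Pe.
  rewrite (bigD1 e) //= big1 => [|f /andP[_ fe]]; rewrite !ffunE.
    by rewrite eqxx addr0; apply: mulr1.
  by rewrite eq_sym (negPf fe) scaler0.
rewrite big1 // => f Pf; rewrite !ffunE; case: eqP => [ef|]; rewrite ?scaler0 //.
by rewrite ef Pf in Pe.
Qed.

Lemma bendP u v :
  bend M u v <-> exists c x, [/\ circuit M c, u = c & v = del c x].
Proof.
have sumE c x : [/\ \sum_(y : E) c y *: basis_elt R y = c &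
    \sum_(y | y != x) c y *: basis_elt R y = del c x].
  rewrite !sum_basis; split; apply/ffunP => y; rewrite !ffunE //.
  by case: eqP.
by split=> -[c [x [Mc -> ->]]]; exists c, x; have [-> ->] := sumE c x.
Qed.

Definition gen e : bend_module M := quot_pi (bend M) (basis_elt R e).

Lemma quot_pi_comb u : quot_pi (bend M) u = comb gen u :> bend_module M.
Proof.
have uE : u = \sum_e u e *: basis_elt R e.
  by rewrite sum_basis; apply/ffunP => e; rewrite ffunE.
pose pi : _ -> bend_module M := quot_pi (bend M).
rewrite -/(pi u) [in LHS]uE (big_morph pi (op1 := +%R) (id1 := 0)) //.
  by apply: eq_bigr => e _; rewrite /pi -quot_scaleE.
by move=> x y; rewrite /pi -quot_addE.
Qed.

Lemma comb_gen_surj (x : bend_module M) : exists u, x = comb gen u.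
Proof. by exists (repr x); rewrite -quot_pi_comb quot_piK. Qed.

(** An equality in the quotient holds in every congruence containing the bend relations, in
    particular in that of [dependent_congruence]; read it at [e]. Conversely, a witnessing circuit
    provides a bend relation at [e]. *)
Lemma gen_leP v e a : mle (a *: gen e) (comb gen v) <-> dependent v e a.
Proof.
split.
  rewrite /mle -comb_basis -combZ -combD -!quot_pi_comb => /quot_piP.
  case/(_ _ dependent_congruence) => [x y /bendP[c [f [Mc -> ->]]]|].
    split=> z; last by left; apply: del_le.
    case: (eqVneq z f) => [->|zf]; last by left; rewrite del_neq.
    by right; exists c => //; split=> // y' y'f; rewrite del_neq.
  move=> /(_ e) + _; apply: dependent_le; rewrite !ffunE eqxx.
  by rewrite -[X in X <= _]mulr1; apply: Rmax_leDl.
case=> [ave|[c Mc [<- cv]]].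
  by apply: mle_trans (comb_ge gen v e); apply: mleZl.
apply: mle_trans (comb_ge gen c e) _.
have -> : comb gen c = comb gen (del c e).
  rewrite -!quot_pi_comb; apply/quot_piP => r _ rbend.
  by apply: rbend; apply/bendP; exists c, e.
apply: comb_mono => y; rewrite ffunE; case: eqVneq => [_|]; last exact: cv.
exact: Rmax_ge0.
Qed.

Lemma comb_gen_leP (N : lSemiModType (Rmax R)) (g : E -> N) u v :
  (forall v e a, mle (a *: g e) (comb g v) <-> dependent v e a) ->
  mle (comb g u) (comb g v) <-> mle (comb gen u) (comb gen v).
Proof.
move=> gP; split=> /comb_leP uv; apply/comb_leP => e.
  by apply/gen_leP/gP.
by apply/gP/gen_leP.
Qed.

(** Equality is the order in both directions, and the order of combinations is determined by
    [dependent]. Hence the same combinations are identified in both modules, and matching them is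
    well defined and injective. *)
Lemma bend_module_iso (N : lSemiModType (Rmax R)) (g : E -> N) :
  (forall x, exists u, x = comb g u) ->
  (forall v e a, mle (a *: g e) (comb g v) <-> dependent v e a) ->
  isomorphic (bend_module M) N.
Proof.
move=> gsurj gP.
have combE u v : comb g u = comb g v <-> comb gen u = comb gen v.
  split=> uv; apply: mle_anti;
    by apply/(comb_gen_leP _ _ gP); rewrite uv.
pose h (p : bend_module M) : N := comb g (repr p).
have hE u : h (comb gen u) = comb g u.
  by apply/combE; rewrite -quot_pi_comb quot_piK.
have hlin : semilinear_for *:%R h.
  split=> [a x|x y].
    by have [u ->] := comb_gen_surj x; rewrite -combZ !hE combZ.
  have [u ->] := comb_gen_surj x; have [v ->] := comb_gen_surj y.
  by rewrite -combD !hE combD.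
pose hL := GRing.isSemilinear.Build _ _ _ _ h hlin.
pose H : {linear bend_module M -> N} := HB.pack h hL.
exists H; have [k kP] := choice gsurj.
exists (fun x => comb gen (k x)) => x /=; last by rewrite hE -kP.
by have [u ->] := comb_gen_surj x; apply/combE; rewrite -kP hE.
Qed.

Lemma finitely_generated_bend_module : finitely_generated (bend_module M).
Proof.
exists #|E|, (fun i => gen (enum_val i)) => x.
have [u ->] := comb_gen_surj x; exists (fun i => u (enum_val i)).
by rewrite /comb (reindex _ (onW_bij _ (@enum_val_bij E))).
Qed.

End BendModule.

(** * Modules whose order is given by the circuits of a valuated matroid *)

Section PresentedModule.
Variables (R : realType) (E : finType) (M : valuated_matroid R E).
Variables (N : lSemiModType (Rmax R)) (g : E -> N).
Hypothesis g_surj : forall x, exists u, x = comb g u.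
Hypothesis g_leP :
  forall v e a, mle (a *: g e) (comb g v) <-> dependent M v e a.
Implicit Types (u v w c d : {ffun E -> Rmax R}) (e f : E) (a b : Rmax R).

(** Used in both directions: when [x] absorbs the other terms of a circuit, its terms at [e] and [f]
    become equal modulo [x]. *)
Lemma circuit_bend c e f (x : N) : circuit M c -> e != f ->
  (forall y, y != e -> y != f -> mle (c y *: g y) x) ->
  mle (c e *: g e) (x + c f *: g f).
Proof.
move=> Mc ef cx; have : dependent M (del c e) e (c e).
  by right; exists c => //; split=> // y ye; rewrite del_neq.
move/g_leP => /mle_trans; apply; apply/comb_leP => y.
case: (eqVneq y e) => [->|ye]; first by rewrite del_eq scale0r.
rewrite del_neq //; case: (eqVneq y f) => [->|yf]; first exact: mleDr.
exact: mle_trans (cx y ye yf) (mleDl _ _).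
Qed.

(** Each term of [z] is examined through a circuit witnessing that it lies below [x + b *: g e].
    Either the circuit needs only [x], or it passes through [e] with a coefficient at most [b], and
    the term may be traded for a multiple of [g e]. *)
Lemma generator_exchange (x z : N) e b :
  mle x z -> mle z (x + b *: g e) -> exists2 a, a <= b & z = x + a *: g e.
Proof.
have [u xE] := g_surj x; have [w zE] := g_surj z.
move=> xz zx; pose v := u + b *: basis_elt R e.
have vE : x + b *: g e = comb g v by rewrite combD combZ comb_basis xE.
have ve : v e = u e + b by rewrite !ffunE eqxx; congr (_ + _); apply: mulr1.
have vy y : y != e -> v y = u y.
  by move=> ye; rewrite !ffunE (negPf ye) scaler0 addr0.
have /choice[k kP] f :
    exists k, k <= b /\ x + w f *: g f = x + k *: g e.
  have below0 : dependent M u f (w f) ->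
      exists a, a <= b /\ x + w f *: g f = x + a *: g e.
    move/g_leP; rewrite -xE => wx; exists 0.
    by rewrite Rmax_ge0 scale0r addr0 addrC.
  have : dependent M v f (w f).
    apply/g_leP; rewrite -vE; apply: mle_trans zx; rewrite zE.
    exact: comb_ge.
  case: (eqVneq f e) => [fe|fe].
    rewrite fe in below0 *; case=> [|[c Mc [ce cv]]].
      rewrite ve Rmax_addE le_max => /orP[we|]; last by exists (w e).
      by apply: below0; left.
    apply: below0; right; exists c => //; split=> // y ye.
    by rewrite -(vy y) ?cv.
  case=> [|[c Mc [cf cv]]]; first by rewrite vy // => wf; apply: below0; left.
  have := cv e; rewrite eq_sym fe ve Rmax_addE le_max => /(_ isT)/orP[ceu|ceb].
    apply: below0; right; exists c => //; split=> // y yf.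
    by case: (eqVneq y e) => [->//|ye]; rewrite -(vy y) ?cv.
  exists (c e); split=> //; rewrite -cf.
  have cx y : y != e -> y != f -> mle (c y *: g y) x.
    by move=> ye yf; rewrite xE; apply/g_leP; left; rewrite -(vy y) ?cv.
  apply: mle_anti; apply: mle_lub => //.
    by apply: circuit_bend => // y yf ye; apply: cx.
  by apply: circuit_bend => //; rewrite eq_sym.
exists (\sum_f k f); first by apply: Rmax_sum_le => f; case: (kP f).
rewrite -(comb_add_scale (u := w) (g := g)) => [|f]; last by case: (kP f).
by rewrite -zE; symmetry.
Qed.

(** Cancellable elements are closed under sums and multiples, so generators suffice. A circuit
    witnessing dependence at [e] is bounded only away from [e], hence is unaffected by the term
    [a *: g e]. *)
Lemma cancellable_presented (y : N) : cancellable y.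
Proof.
have [u ->] := g_surj y.
apply: (big_ind (fun y : N => cancellable y)) => [|? ?|e _].
- exact: cancellable0.
- exact: cancellableD.
apply: cancellableZ => x a b ab; have [v ->] := g_surj x.
rewrite -{2}[g e]comb_basis -combZ -combD => /g_leP H; apply/g_leP.
case: H => [|[c Mc [ce cv]]].
  rewrite !ffunE eqxx Rmax_addE le_max => /orP[bv|]; first by left.
  by rewrite -[X in _ <= X]/(a * 1) mulr1 leNgt ab.
right; exists c => //; split=> // z ze; apply: le_trans (cv z ze) _.
by rewrite !ffunE (negPf ze) scaler0 addr0.
Qed.

Lemma weakly_covers_generator (x : N) e b :
  weakly_covers x (x + b *: g e).
Proof.
split=> [|z [xz zx]]; first exact: mleDl.
have [a ab ->] := generator_exchange xz zx.
have [b0|b0] := eqVneq b 0.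
  exists 0; first exact: Rmax_ge0.
  by move: ab; rewrite b0 Rmax_le0 => /eqP ->; rewrite !scale0r.
pose k := a * Rmax_inv b.
have k1 : k <= 1 by rewrite -(Rmax_mulVx b0) /k mulrC; apply: Rmax_leM2l.
exists k => //; rewrite scalerDr addrA scalerA -mulrA Rmax_mulVx // mulr1.
congr (_ + _); rewrite addrC; symmetry; rewrite -{2 3}[x]scale1r.
exact: mleZl.
Qed.


(** If [y] weakly covers [x], each term of [y] is a multiple [k e *: y] modulo [x]. The sum of the
    [k e] is a maximum, attained at one [e], so [y] is [x] plus a single term, and this form
    survives adding [z]. *)
Lemma semimodular_presented : semimodular (N).
Proof.
move=> x y z [xy cover].
suff [->|[e [b ->]]] : y = x \/ exists e b, y = x + b *: g e.
- split=> // w [xw wx]; exists 0; first exact: Rmax_ge0.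
  by rewrite scale0r addr0; apply: mle_anti.
- by rewrite addrAC; apply: weakly_covers_generator.
have [u yE] := g_surj y.
have /choice[k kP] e : exists k : Rmax R, x + u e *: g e = x + k *: y.
  have [|k _ kE] := cover (x + u e *: g e); last by exists k.
  by split=> //; apply: mle_lub => //; rewrite yE; apply: comb_ge.
have := comb_add_scale kP; rewrite -yE {1}xy.
have [->|[e ->]] := Rmax_sum_attained k.
  by rewrite scale0r addr0; left.
by rewrite -kP => ->; right; exists e, (u e).
Qed.

Lemma strongly_torsion_free_presented : strongly_torsion_free (N).
Proof. exact/strongly_torsion_freeP/cancellable_presented. Qed.

(** The terms of [x] are multiples of [x], and the largest of them is [x] itself. *)
Lemma atom_generator_multiple (x : N) :
  atom x -> exists e a, a != 0 /\ x = a *: g e.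
Proof.
move=> xat; have x0 := atom_neq0 xat; case/atomP: xat => surj _.
have [u xE] := g_surj x.
have /choice[k kP] e :
    exists k : Rmax R, 0 + u e *: g e = 0 + k *: x.
  have [|k _ ->] := surj (u e *: g e); last by exists k.
  by rewrite xE; apply: comb_ge.
have := comb_add_scale kP; rewrite -xE !add0r.
have [->|[e ->]] := Rmax_sum_attained k.
  by rewrite scale0r => xz; rewrite xz eqxx in x0.
have := kP e; rewrite !add0r => <- xe; exists e, (u e); split=> //.
by apply: contra_neq x0; rewrite xe => ->; rewrite scale0r.
Qed.

Lemma circuit_vector c : circuit M c -> vector g c.
Proof.
move=> Mc e; apply/g_leP; right; exists c => //; split=> // y ye.
by rewrite del_neq.
Qed.

(** Thus vectors are maxima of circuits: the bend relation at [e] can only be witnessed by a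
    circuit, since [del c e] vanishes at [e]. *)
Lemma vector_circuit c e : vector g c -> c e != 0 ->
  exists2 d, circuit M d & d e = c e /\ forall y, d y <= c y.
Proof.
move=> cv ce; have /g_leP[|[d Md [de dc]]] := cv e.
  by rewrite del_eq Rmax_le0 (negPf ce).
exists d => //; split=> // y; have [->|ye] := eqVneq y e; first by rewrite de.
exact: le_trans (dc y ye) (del_le _ _ _).
Qed.

Lemma circuit_supp_eq c d : circuit M c -> circuit M d ->
  (forall e, d e = 0 -> c e = 0) -> forall e, c e = 0 -> d e = 0.
Proof.
move=> Mc Md dc e ce; apply: contrapT => /eqP de.
have /negP[] : ~~ (supp c \subset supp d).
  apply: (circuit_incomp Mc Md) => cd.
  have : e \in supp d by rewrite inE.
  by rewrite -cd inE ce eqxx.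
apply/fintype.subsetP => f; rewrite !inE; apply: contra => /eqP /dc ->.
exact: eqxx.
Qed.

(** A vector supported inside a circuit contains a circuit, which has the same support by
    incomparability. Conversely, a minimal vector [c] dominates a circuit [d] meeting it at [e]; if
    they differed at [y], eliminating [e] between [d] and a circuit meeting [c] at [y] would give a
    circuit of smaller support. *)
Lemma circuitP c : circuit M c <-> min_vector g c.
Proof.
split=> [Mc|[c0 cv cmin]].
  split; [|exact: circuit_vector|].
    by apply/eqP => c0; apply: (@circuit_neq0 _ _ M); rewrite -c0.
  move=> d d0 dv cd e de.
  have [f df] := (ffun_neq0P d).1 d0.
  have [d' Md' [_ d'd]] := vector_circuit dv df.
  have d'0 y : d y = 0 -> d' y = 0.
    by move=> dy; apply/eqP; rewrite -Rmax_le0 -dy.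
  by apply: (circuit_supp_eq Md' Mc) => [y /cd|]; apply: d'0.
have [e ce] := (ffun_neq0P c).1 c0.
have [d Md [de dc]] := vector_circuit cv ce.
suff -> : c = d by [].
have sub c' : (forall y, c' y <= c y) -> forall y, c y = 0 -> c' y = 0.
  by move=> c'c y cy; apply/eqP; rewrite -Rmax_le0 -cy.
have sup c' : circuit M c' -> (forall y, c' y <= c y) ->
    forall y, c' y = 0 -> c y = 0.
  move=> Mc' c'c; apply: cmin; [|exact: circuit_vector|exact: sub].
  by apply/eqP => c'0; apply: (@circuit_neq0 _ _ M); rewrite -c'0.
apply/ffunP => y; apply/eqP; rewrite eq_le dc andbT leNgt; apply/negP => dcy.
have cy : c y != 0.
  by rewrite -Rmax_gt0; apply: le_lt_trans dcy; apply: Rmax_ge0.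
have [d' Md' [d'y d'c]] := vector_circuit cv cy.
have d'e : d' e != 0 by apply: contra_neq ce; apply: sup.
(* Rescaled so as to agree with [d] at [e], [d'] exceeds [d] at [y]. *)
pose k := d e * Rmax_inv (d' e).
have k1 : 1 <= k :> Rmax R.
  rewrite -(Rmax_mulVx d'e) mulrC; apply: Rmax_leM2r; rewrite de; exact: d'c.
have k0 : k != 0 by rewrite -Rmax_gt0; apply: lt_le_trans k1; rewrite Rmax_gt0.
have ke : (k *: d') e = d e.
  by rewrite ffunE -[LHS]/(k * d' e) -mulrA Rmax_mulVx ?mulr1.
have ky : d y < (k *: d') y.
  apply: lt_le_trans dcy _; rewrite -d'y ffunE -[X in X <= _]mul1r.
  exact: Rmax_leM2r.
have [|Z [MZ Ze Zy Zle]] := circuit_elim (circuit_scale Md' k0) Md ke _ ky.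
  by rewrite ke de.
have Zd f : d f = 0 -> Z f = 0.
  move=> df; apply/eqP; rewrite -Rmax_le0; apply: le_trans (Zle f) _.
  by rewrite ge_max df lexx ffunE (sub d' d'c) ?scaler0 ?lexx // (sup d).
have := circuit_supp_eq MZ Md Zd Ze; rewrite de => /eqP.
by rewrite (negPf ce).
Qed.

Hypothesis Msimple : simple_vmatroid M.

(** Simplicity enters here: any other witness would be a circuit supported in [{e, f}]. *)
Lemma generator_le e f a b : a != 0 -> mle (a *: g e) (b *: g f) ->
  e = f /\ a <= b.
Proof.
move=> a0; rewrite -[g f]comb_basis -combZ => /g_leP[|[c Mc [_ cb]]].
  rewrite !ffunE; case: eqVneq => [->|_]; last first.
    by rewrite scaler0 Rmax_le0 (negPf a0).
  by rewrite -[X in _ <= X]/(b * 1) mulr1.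
have := Msimple Mc; rewrite leqNgt ltnS; case/negP.
have /subset_leq_card/leq_trans : supp c \subset [set e; f]%SET; last first.
  by apply; rewrite cards2; case: (_ != _).
apply/fintype.subsetP => y; rewrite !inE; apply: contraR.
rewrite negb_or => /andP[ye yf]; rewrite -Rmax_le0.
by apply: le_trans (cb y ye) _; rewrite !ffunE (negPf yf) scaler0.
Qed.

Lemma generator_atom e : atom (g e).
Proof.
apply/atomP; split=> [z|a b _ _ ab]; last first.
  have le a' b' : a' *: g e = b' *: g e -> a' <= b'.
    have [->|a0 E'] := eqVneq a' 0; first by rewrite Rmax_ge0.
    by have [] := @generator_le e e a' b' a0; rewrite ?E'.
  by apply/le_anti/andP; split; apply: le.
rewrite -[g e]scale1r -{1}[_ *: _]add0r.
case/(generator_exchange (mle0 z)) => a a1 ->; exists a => //.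
by rewrite add0r scale1r.
Qed.

Lemma atomic_presented : atomic (N).
Proof.
move=> x; have [u ->] := g_surj x.
exists [seq u e *: g e | e <- enum E & u e != 0] => [t|].
  case/mapP => e; rewrite mem_filter => /andP[ue _] ->.
  exact: atomZ ue (generator_atom e).
rewrite big_map big_filter big_enum_cond /= /comb.
rewrite (bigID (fun e => u e != 0)) /= [X in _ + X]big1 ?addr0 //.
by move=> e /negPn/eqP ->; rewrite scale0r.
Qed.

End PresentedModule.

(** * Isomorphisms and projective equivalences *)

Lemma min_vector_ext (R : realType) (E : finType)
    (N N' : lSemiModType (Rmax R)) (g : E -> N) (g' : E -> N') c :
  (forall d, vector g d <-> vector g' d) -> min_vector g c -> min_vector g' c.
Proof.
move=> gg' [c0 cv cmin]; split=> //; first exact/gg'.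
by move=> d d0 dv; apply: cmin => //; apply/gg'.
Qed.

Section Isomorphism.
Variables (R : realType) (N N' : lSemiModType (Rmax R)).
Variables (h : {linear N -> N'}) (h_inj : injective h).

Lemma mle_linear x y : mle (h x) (h y) <-> mle x y.
Proof.
by rewrite /mle -linearD; split=> [/h_inj|->].
Qed.

Lemma comb_linear (E : finType) (g : E -> N) u : comb (h \o g) u = h (comb g u).
Proof. by rewrite /comb linear_sum; apply: eq_bigr => e _; rewrite linearZ. Qed.

Lemma vector_linear (E : finType) (g : E -> N) c :
  vector (h \o g) c <-> vector g c.
Proof.
by split=> cv e; move: (cv e); rewrite comb_linear /= -linearZ mle_linear.
Qed.

Lemma min_vector_linear (E : finType) (g : E -> N) c :
  min_vector (h \o g) c <-> min_vector g c.
Proof.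
split; apply: min_vector_ext => d; first exact: vector_linear.
by apply: iff_sym; apply: vector_linear.
Qed.

Lemma atom_linear x : (forall y, exists z, y = h z) -> atom (h x) <-> atom x.
Proof.
move=> h_surj; rewrite !atomP; split=> -[surj inj]; split.
- by move=> z /mle_linear/surj[a a1]; rewrite -linearZ => /h_inj ->; exists a.
- by move=> a b a1 b1 ab; apply: inj => //; rewrite -!linearZ ab.
- move=> z; have [{}z ->] := h_surj z => /mle_linear/surj[a a1 ->].
  by exists a; rewrite // linearZ.
- by move=> a b a1 b1; rewrite -!linearZ => /h_inj; apply: inj.
Qed.

End Isomorphism.

Section Rescaling.
Variables (R : realType) (E E' : finType).
Variables (phi : E -> E') (phi_inv : E' -> E) (s : E -> Rmax R).
Hypotheses (phiK : cancel phi phi_inv) (phi_invK : cancel phi_inv phi).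
Hypothesis s_neq0 : forall e, s e != 0.
Implicit Types (u v c d : {ffun E -> Rmax R}).

Definition rescale u : {ffun E' -> Rmax R} :=
  [ffun y => s (phi_inv y) * u (phi_inv y)].

Definition unrescale (v : {ffun E' -> Rmax R}) : {ffun E -> Rmax R} :=
  [ffun e => Rmax_inv (s e) * v (phi e)].

Lemma rescaleE u e : rescale u (phi e) = s e * u e.
Proof. by rewrite ffunE phiK. Qed.

Lemma unrescaleK (v : {ffun E' -> Rmax R}) : rescale (unrescale v) = v.
Proof. by apply/ffunP => y; rewrite !ffunE phi_invK Rmax_mulVKx. Qed.

Lemma rescale_del u e : rescale (del u e) = del (rescale u) (phi e).
Proof.
apply/ffunP => y; rewrite !ffunE (can2_eq phi_invK phiK).
by case: ifP => // _; rewrite mulr0.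
Qed.

Lemma comb_rescale (N : lSemiModType (Rmax R)) (g : E' -> N) u :
  comb g (rescale u) = comb (fun e => s e *: g (phi e)) u.
Proof.
rewrite /comb (reindex phi) /=; last by exists phi_inv => x _.
by apply: eq_bigr => e _; rewrite rescaleE scalerA mulrC.
Qed.

Lemma vector_rescale (N : lSemiModType (Rmax R)) (g : E' -> N) c :
  vector g (rescale c) <-> vector (fun e => s e *: g (phi e)) c.
Proof.
split=> cv; last first.
  move=> y; rewrite -(phi_invK y) -rescale_del comb_rescale rescaleE mulrC.
  by rewrite -scalerA.
by move=> e; rewrite -comb_rescale rescale_del scalerA mulrC -rescaleE.
Qed.

Lemma rescale_eq0 u e : rescale u (phi e) = 0 <-> u e = 0.
Proof.
rewrite rescaleE; split=> [/eqP|->]; last exact: mulr0.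
by rewrite Rmax_mul_eq0 (negPf (s_neq0 e)) => /eqP.
Qed.

Lemma rescale_neq0 u : rescale u != 0 <-> u != 0.
Proof.
rewrite !ffun_neq0P; split=> -[e ue].
  exists (phi_inv e); apply: contra_neq ue => ue.
  by rewrite -(phi_invK e); apply/rescale_eq0.
by exists (phi e); apply: contra_neq ue => /rescale_eq0.
Qed.

Lemma min_vector_rescale (N : lSemiModType (Rmax R)) (g : E' -> N) c :
  min_vector g (rescale c) <-> min_vector (fun e => s e *: g (phi e)) c.
Proof.
split=> -[c0 cv cmin].
  split; [exact/rescale_neq0|exact/vector_rescale|].
  move=> d d0 dv cd e de; apply/rescale_eq0; apply: (cmin (rescale d)).
  - exact/rescale_neq0.
  - exact/vector_rescale.
  - by move=> y; rewrite -(phi_invK y) !rescale_eq0; apply: cd.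
  - exact/rescale_eq0.
split; [exact/rescale_neq0|exact/vector_rescale|].
move=> d; rewrite -(unrescaleK d) => /rescale_neq0 d0 /vector_rescale dv cd y.
rewrite -(phi_invK y) !rescale_eq0; apply: cmin => // e ce.
by apply/rescale_eq0/cd/rescale_eq0.
Qed.

Lemma dependent_rescale (M : valuated_matroid R E) (M' : valuated_matroid R E')
    v e a : (forall c, circuit M c <-> circuit M' (rescale c)) ->
  dependent M' (rescale v) (phi e) (s e * a) <-> dependent M v e a.
Proof.
move=> MM'; rewrite /dependent rescaleE Rmax_leM2lE //.
split=> -[|[c Mc [ce cv]]]; [by left|right|by left|right].
  rewrite -(unrescaleK c) in Mc ce cv; exists (unrescale c); first exact/MM'.
  split=> [|y ye].
    move: ce; rewrite rescaleE => /(congr1 ( *%R (Rmax_inv (s e)))).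
    by rewrite !Rmax_mulKx.
  have := cv (phi y); rewrite !rescaleE Rmax_leM2lE //; apply.
  by rewrite (inj_eq (can_inj phiK)).
exists (rescale c); first exact/MM'.
split=> [|y ye]; first by rewrite rescaleE ce.
rewrite -(phi_invK y) !rescaleE Rmax_leM2lE //; apply: cv.
by apply: contra_neq ye => <-; rewrite phi_invK.
Qed.

End Rescaling.

Lemma proj_equiv_isomorphic (R : realType) (E E' : finType)
    (M : valuated_matroid R E) (M' : valuated_matroid R E') :
  proj_equiv M M' -> isomorphic (bend_module M) (bend_module M').
Proof.
case=> phi [phi_inv [s [phiK phi_invK s0 MM']]].
apply: (bend_module_iso (g := fun e => s e *: gen M' (phi e))) => [x|v e a].
  have [v ->] := comb_gen_surj x; exists (unrescale phi s v).
  by rewrite -(comb_rescale s phiK phi_invK) unrescaleK.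
rewrite -(comb_rescale s phiK phi_invK) scalerA mulrC gen_leP.
exact: dependent_rescale.
Qed.

Lemma isomorphic_proj_equiv (R : realType) (E E' : finType)
    (M : valuated_matroid R E) (M' : valuated_matroid R E') :
  simple_vmatroid M -> simple_vmatroid M' ->
  isomorphic (bend_module M) (bend_module M') -> proj_equiv M M'.
Proof.
move=> Ms Ms' [h h_bij]; have h_inj := bij_inj h_bij.
have h_surj y : exists x, y = h x by case: h_bij => k _ kK; exists (k y).
have surj := @comb_gen_surj _ _ M; have leP := @gen_leP _ _ M.
have surj' := @comb_gen_surj _ _ M'; have leP' := @gen_leP _ _ M'.
have /choice[p pP] e : exists p : E' * Rmax R,
    p.2 != 0 /\ h (gen M e) = p.2 *: gen M' p.1.
  have /(atom_generator_multiple surj')[f [a [a0 ->]]] :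
      atom (h (gen M e)).
    exact/(atom_linear h_inj)/(generator_atom surj leP Ms).
  by exists (f, a).
pose phi e := (p e).1; pose s e := (p e).2.
have s0 e : s e != 0 by case: (pP e).
have hE e : h (gen M e) = s e *: gen M' (phi e) by case: (pP e).
(* The preimage of the atom [gen M' y] is a multiple of some [gen M e], so [gen M' y] lies on the
   line of [gen M' (phi e)], and [generator_le] identifies the two indices. *)
have /choice[phi_inv phi_invK] y : exists e, phi e = y.
  have [x xE] := h_surj (gen M' y).
  have /(atom_generator_multiple surj)[e [a [a0 xa]]] : atom x.
    apply/(atom_linear h_inj) => //; rewrite -xE.
    exact: generator_atom surj' leP' Ms' _.
  exists e; have : mle (1 *: gen M' y) ((a * s e) *: gen M' (phi e)).
    by rewrite scale1r xE xa linearZ /= hE scalerA.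
  by case/(generator_le leP' Ms') => [|-> //]; apply: oner_neq0.
have phi_inj : injective phi.
  move=> e f ef.
  have : mle (Rmax_inv (s e) *: gen M e) (Rmax_inv (s f) *: gen M f).
    by apply/(mle_linear h_inj); rewrite !linearZ /= !hE !scale_invK // ef.
  by case/(generator_le leP Ms) => //; apply: Rmax_inv_neq0.
have phiK : cancel phi phi_inv by move=> e; apply: phi_inj.
exists phi, phi_inv, s; split=> // eta.
rewrite -/(rescale phi_inv s eta).
(* Circuits on both sides are minimal vectors of the bend modules, and [h] carries one generating
   family to the rescaled other. *)
rewrite (circuitP leP) (circuitP leP') min_vector_rescale //.
rewrite -(min_vector_linear h_inj).
have -> // : h \o gen M = fun e => s e *: gen M' (phi e).
by apply/funext => e; rewrite /= hE.
Qed.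

(** * The matroid of a geometric module *)

Section MatroidOfAtoms.
Variables (R : realType) (N : lSemiModType (Rmax R)) (E : finType) (g : E -> N).
Hypotheses (smod : semimodular N) (canc : forall y : N, cancellable y).
Hypothesis g_atom : forall e, atom (g e).
Hypothesis g_indep : forall e f a, g e = a *: g f -> e = f.

Fact min_vector_neq0 : ~ min_vector g 0.
Proof. by case; rewrite eqxx. Qed.

Fact min_vector_incomp X Y : min_vector g X -> min_vector g Y ->
  supp X <> supp Y -> ~~ (supp X \subset supp Y).
Proof.
move=> [X0 Xv _] [_ _ Ymin] nXY; apply/negP => XY; apply: nXY.
apply/eqP; rewrite finset.eqEsubset XY; apply/fintype.subsetP => e.
rewrite !inE; apply: contra => /eqP Xe; apply/eqP.
apply: (Ymin X) Xe => // f Yf; apply/eqP; apply: contraT => Xf.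
by have := fintype.subsetP XY f; rewrite !inE Xf Yf eqxx => /(_ isT).
Qed.

(** [vector_elim] yields an inequality avoiding [u], and [min_vector_through] shrinks it to a
    minimal vector with the prescribed value at [v]. *)
Fact min_vector_circuit_elim X Y u v : min_vector g X -> min_vector g Y ->
  X u = Y u -> X u != 0 -> Y v < X v ->
  exists Z, [/\ min_vector g Z, Z u = 0, Z v = X v &
    forall e, Z e <= Order.max (X e) (Y e)].
Proof.
move=> [_ Xv _] [_ Yv _] XYu Xu XYv.
have uv : u != v by apply: contraTneq XYv => <-; rewrite XYu ltxx.
have X0 : 0 < X v :> Rmax R by apply: le_lt_trans XYv; apply: Rmax_ge0.
have := vector_elim canc Xv Yv XYu XYv.
case/(min_vector_through smod canc g_atom).
  by rewrite del_neq 1?eq_sym // del_eq.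
move=> Z Zmin [Zv Zle]; exists Z; split=> //.
  by apply/eqP; rewrite -Rmax_le0; apply: le_trans (Zle u uv) _; rewrite del_eq.
move=> e; have [->|ev] := eqVneq e v; first by rewrite Zv le_max lexx.
apply: le_trans (Zle e ev) _; apply: le_trans (del_le _ _ _) _.
by apply: le_trans (del_le _ _ _) _; rewrite ffunE Rmax_addE.
Qed.

Definition matroid_of_atoms : valuated_matroid R E :=
  ValuatedMatroid min_vector_neq0 min_vector_incomp
    (fun X a Xmin a0 => min_vectorZ a0 Xmin) min_vector_circuit_elim.

(** A circuit with at most two elements would put a multiple of [g e] below a multiple of another
    [g f]. Only multiples of an atom lie below it, so the two atoms would share a line. *)
Lemma simple_matroid_of_atoms : simple_vmatroid matroid_of_atoms.
Proof.
move=> c [c0 cv _]; have [e ce] := (ffun_neq0P c).1 c0.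
rewrite leqNgt; apply/negP => c3.
have cg0 : c e *: g e != 0 by apply: scale_neq0 ce (atom_neq0 (g_atom e)).
have [f] : exists f, mle (c e *: g e) (c f *: g f) /\ f != e.
  apply: contrapT => nf.
  have [f fe cf] : exists2 f, f != e & c f != 0.
    apply: contrapT => nf'; have := cv e; rewrite (_ : del c e = 0) ?comb0.
      by move/mle_le0/eqP; rewrite (negPf cg0).
    apply/ffunP => f; rewrite !ffunE; case: eqVneq => // fe.
    by apply: contrapT => /eqP cf; apply: nf'; exists f.
  apply: nf; exists f; split=> //; apply: mle_trans (cv e) _.
  apply/comb_leP => y.
  have [->|ye] := eqVneq y e; first by rewrite del_eq scale0r.
  have [->|yf] := eqVneq y f; first by rewrite del_neq.
  suff /eqP cy : c y == 0 by rewrite del_neq // cy scale0r.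
  apply: contraTT c3 => cy; rewrite -leqNgt.
  have <- : #|[set e; f; y]%SET| = 3%N.
    rewrite -finset.setUA !cardsU1 cards1 !inE ![e == _]eq_sym [f == y]eq_sym.
    by rewrite (negPf fe) (negPf ye) (negPf yf).
  apply: subset_leq_card; apply/fintype.subsetP => z.
  by rewrite !inE -orbA => /or3P[] /eqP ->.
case=> le fe; have [c0f|cf] := eqVneq (c f) 0.
  by move: le; rewrite c0f scale0r => /mle_le0/eqP; rewrite (negPf cg0).
have /atomP[/(_ _ le)[k _ E'] _] := atomZ cf (g_atom f).
case/eqP: fe; symmetry; apply: (g_indep (a := Rmax_inv (c e) * (k * c f))).
by rewrite -!scalerA -E' scale_invK.
Qed.

Lemma matroid_of_atomsP v e a :
  mle (a *: g e) (comb g v) <-> dependent matroid_of_atoms v e a.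
Proof.
split=> [av|[av|[c [_ cv _] [<- cle]]]].
- have [av'|va] := leP a (v e); [by left|right].
  exact: min_vector_through av va.
- by apply: mle_trans (comb_ge g v e); apply: mleZl.
- apply: mle_trans (cv e) _; apply: comb_mono => y; rewrite ffunE.
  by case: eqVneq => [_|]; [rewrite Rmax_ge0|apply: cle].
Qed.

End MatroidOfAtoms.

(** Greedy choice of one atom per line: a new atom is kept only if it is no multiple of those
    already kept. Invertibility of nonzero scalars gives the reverse comparison. *)
Lemma independent_atoms (R : realType) (N : lSemiModType (Rmax R)) (s : seq N) :
  (forall t, t \in s -> atom t) ->
  exists s' : seq N, [/\ forall t, t \in s' -> atom t,
    forall t, t \in s -> exists2 y, y \in s' & exists a, t = a *: y &
    forall x y a, x \in s' -> y \in s' -> x = a *: y -> x = y].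
Proof.
elim: s => [|x s IH] sat; first by exists [::].
have xat : atom x by apply: sat; rewrite mem_head.
have [|s' [s'at ss' s'ind]] := IH.
  by move=> t ts; apply: sat; rewrite inE ts orbT.
have [[y ys' [a xE]]|nx] :=
    pselect (exists2 y, y \in s' & exists a, x = a *: y).
  exists s'; split=> // t; rewrite inE => /orP[/eqP ->|/ss' //].
  by exists y => //; exists a.
exists (x :: s'); split=> [t|t|t y a].
- by rewrite inE => /orP[/eqP ->|/s'at].
- rewrite inE => /orP[/eqP ->|/ss'[y ys' ty]].
    by exists x; rewrite ?mem_head //; exists 1; rewrite scale1r.
  by exists y; rewrite // inE ys' orbT.
- rewrite !inE => /orP[/eqP ->|ts] /orP[/eqP ->|ys] //.
  + by move=> xE; case: nx; exists y => //; exists a.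
  + move=> tE; have a0 : a != 0.
      by apply: contra_neq (atom_neq0 (s'at t ts)) => a0; rewrite tE a0 scale0r.
    by case: nx; exists t => //; exists (Rmax_inv a); rewrite tE scale_invK.
  + exact: s'ind.
Qed.

Lemma geometric_is_bend_module (R : realType) (N : lSemiModType (Rmax R)) :
  finitely_generated N -> geometric N ->
  exists (E : finType) (M : valuated_matroid R E),
    simple_vmatroid M /\ isomorphic (bend_module M) N.
Proof.
case=> n [h hgen] [Nat smod /strongly_torsion_freeP canc].
have /choice[l lP] i : exists l : seq N,
    (forall t, t \in l -> atom t) /\ h i = \sum_(t <- l) t.
  by have [l lat hE] := Nat (h i); exists l.
(* The ground set represents the lines of the finitely many atoms that occur in chosen
   decompositions of the generators [h i]. *)
have [|s [sat ss sind]] :=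
    @independent_atoms _ _ (flatten [seq l i | i <- enum 'I_n]).
  by move=> t /flatten_mapP[i _]; apply: (lP i).1.
pose g (e : seq_sub s) : N := val e.
have g_atom e : atom (g e) by apply: sat; apply: valP.
have g_indep e f a : g e = a *: g f -> e = f.
  by move/sind => /(_ (valP _) (valP _)) /val_inj.
exists (seq_sub s), (matroid_of_atoms smod canc g_atom).
split; first exact: simple_matroid_of_atoms.
apply: (bend_module_iso (g := g)) => [x|v e a]; last exact: matroid_of_atomsP.
pose gend y := exists u, y = comb g u.
have gend0 : gend 0 by exists 0; rewrite comb0.
have gendD y z : gend y -> gend z -> gend (y + z).
  by move=> [u ->] [v ->]; exists (u + v); rewrite combD.
have gendZ a y : gend y -> gend (a *: y).
  by move=> [u ->]; exists (a *: u); rewrite combZ.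
have [k ->] := hgen x; apply: (big_ind gend) => // i _; apply: (gendZ _).
have [lat ->] := lP i; rewrite big_seq; apply: (big_ind gend) => // t tl.
have [|y ys [a ->]] := ss t.
  by apply/flatten_mapP; exists i; rewrite ?mem_enum.
by apply: gendZ; exists (basis_elt R (SeqSub ys)); rewrite comb_basis.
Qed.

Theorem theorem4p25 (R : realType) :
  [/\ (forall (E : finType) (M : valuated_matroid R E),
         simple_vmatroid M -> finitely_generated (bend_module M) /\ geometric (bend_module M)),
      (forall (E E' : finType)
              (M : valuated_matroid R E) (M' : valuated_matroid R E'),
         simple_vmatroid M -> simple_vmatroid M' ->
         (proj_equiv M M' <-> isomorphic (bend_module M) (bend_module M')))
    & (forall N : lSemiModType (Rmax R),
         finitely_generated N -> geometric N ->
         exists (E : finType) (M : valuated_matroid R E),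
           simple_vmatroid M /\ isomorphic (bend_module M) N)].
Proof.
split=> [E M Ms|E E' M M' Ms Ms'|]; last exact: geometric_is_bend_module.
  split; first exact: finitely_generated_bend_module.
  have surj := @comb_gen_surj _ _ M; have leP := @gen_leP _ _ M.
  split; first exact: atomic_presented surj leP Ms.
    exact: semimodular_presented surj leP.
  exact: strongly_torsion_free_presented surj leP.
by split; [apply: proj_equiv_isomorphic|apply: isomorphic_proj_equiv].
Qed.
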